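(* Let $\mathcal I$ be a three-dimensional cyclic matching instance with complete preference lists and $n$ agents per class that is derived from a $3$-master list. If $n\ge 3$, then $\mathcal I$ admits no popular matching.
   Context: A three-dimensional cyclic matching instance with complete lists consists of three pairwise disjoint finite sets (agent classes) $A,B,C$ with $|A|=|B|=|C|=n$. Each agent in $A$ (resp. $B$, resp. $C$) has a strict preference list ranking all agents in $B$ (resp. $C$, resp. $A$); $\succ_x$ denotes the strict order of agent $x$, $y\succ_x z$ meaning that $x$ prefers $y$ to $z$. By convention $x$ itself is placed at the end of $\succ_x$ (being unmatched is worst). Let $V=A\cup B\cup C$. A matching $M$ is a subset of $A\times B\times C$ such that each agent appears in at most one triple. If $(a,b,c)\in M$, write $M(a)=b$, $M(b)=c$, $M(c)=a$; if $x$ is in no triple of $M$, then $M(x)=x$. For matchings $M',M$ and an agent $x$, let $\mathrm{vote}_x(M',M)=1$ if $M'(x)\succ_x M(x)$, $0$ if $M'(x)=M(x)$, and $-1$ if $M(x)\succ_x M'(x)$. $M'$ is more popular than $M$ if $\sum_{x\in V}\mathrm{vote}_x(M',M)\ge 1$. $M$ is popular if no matching is more popular than $M$. The preferences of an agent class are derived from a master list if there is a single strict order (of the agents of the class it ranks) from which the preference list of each agent in the class is obtained by deleting some agents; with complete lists this means that all agents in the class have the same preference list. An instance is derived from a $k$-master list ($k\in\{1,2,3\}$) if the preferences of $k$ of the three agent classes are each derived from a master list. *)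

(* Defs.v *)
From mathcomp Require Import all_boot all_order all_algebra.

Set Implicit Arguments.
Unset Strict Implicit.
Unset Printing Implicit Defensive.

Import Order.TTheory GRing.Theory Num.Theory.

(* Preference lists and master lists are sequences of agents, best first. *)
Definition complete_list (T : finType) (s : seq T) : bool :=
  uniq s && [forall x, x \in s].

Record instance (A B C : finType) := Instance {
  listA : A -> seq B;
  listB : B -> seq C;
  listC : C -> seq A;
  listA_complete : forall a, complete_list (listA a);
  listB_complete : forall b, complete_list (listB b);
  listC_complete : forall c, complete_list (listC c)
}.

(* Deleting agents from the master list [m] yields a [subseq] of [m]. *)
Definition master_list_derived (X Y : finType) (l : X -> seq Y) : Prop :=
  exists2 m : seq Y, complete_list m & forall x, subseq (l x) m.

(* The three booleans select the [k] classes. *)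
Definition k_master_list_derived (A B C : finType) (k : nat)
    (I : instance A B C) : Prop :=
  exists dA dB dC : bool,
    [/\ dA + dB + dC = k,
        dA -> master_list_derived (listA I),
        dB -> master_list_derived (listB I)
      & dC -> master_list_derived (listC I)].

Section Matchings.

Variables A B C : finType.
Implicit Types (I : instance A B C) (M : {set A * B * C}).

(* The disjoint union V of the three agent classes. *)
Definition agent : finType := (A + B + C)%type.

Definition agentA (a : A) : agent := inl (inl a).
Definition agentB (b : B) : agent := inl (inr b).
Definition agentC (c : C) : agent := inr c.

Definition occurs (x : agent) (t : A * B * C) : bool :=
  match x with
  | inl (inl a) => t.1.1 == a
  | inl (inr b) => t.1.2 == b
  | inr c => t.2 == c
  end.

Definition matching M : Prop :=
  forall x : agent, #|[set t in M | occurs x t]| <= 1.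

(* The agent that follows [x] in the cyclic order of a triple containing [x]. *)
Definition successor (x : agent) (t : A * B * C) : agent :=
  match x with
  | inl (inl _) => agentB t.1.2
  | inl (inr _) => agentC t.2
  | inr _ => agentA t.1.1
  end.

(* M(x); the triple picked is the only one containing [x] if M is a matching. *)
Definition partner M (x : agent) : agent :=
  if [pick t in M | occurs x t] is Some t then successor x t else x.

(* The list of [x], with [x] itself placed at the end. *)
Definition pref_list I (x : agent) : seq agent :=
  rcons match x with
        | inl (inl a) => map agentB (listA I a)
        | inl (inr b) => map agentC (listB I b)
        | inr c => map agentA (listC I c)
        end x.

Definition prefers I (x y z : agent) : bool :=
  index y (pref_list I x) < index z (pref_list I x).

Definition vote I (x : agent) (M' M : {set A * B * C}) : int :=
  if prefers I x (partner M' x) (partner M x) then 1%R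
  else if prefers I x (partner M x) (partner M' x) then (-1)%R
  else 0%R.

Definition more_popular I (M' M : {set A * B * C}) : Prop :=
  (1 <= \sum_(x : agent) vote I x M' M)%R.

Definition popular I M : Prop :=
  matching M /\ ~ exists2 M', matching M' & more_popular I M' M.

End Matchings.

(* Main.v *)
Require Import Defs.
From mathcomp Require Import all_boot all_order all_algebra.
From mathcomp Require Import zify.

(** A popular matching is perfect, since otherwise a triple of unmatched agents
could be added to it.  Given a perfect matching, reassign to every agent of
[A] and of [B] the agent that its class's common list ranks just above its
current partner, cyclically: in each of the two classes all agents but one
improve.  This amounts to permuting the partners of the agents of [C] in some
way, and a permutation of the partners either changes nothing or improves at
least one agent, so at most [n - 1] agents of [C] get worse and one improves.
The total is therefore at least [2 (n - 2) - (n - 2) = n - 2 > 0]. *)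

Set Implicit Arguments.
Unset Strict Implicit.
Unset Printing Implicit Defensive.

Import Order.TTheory GRing.Theory Num.Theory.

Local Open Scope ring_scope.

(** * Votes as comparisons of ranks in a list *)

Section Ranks.

(** Here [i] is the rank of the new partner and [j] that of the old one; a smaller rank is
    better. *)
Definition rank_vote (i j : nat) : int :=
  if (i < j)%N then 1 else if (j < i)%N then -1 else 0.

Lemma rank_vote_geN1 i j : -1 <= rank_vote i j.
Proof. by rewrite /rank_vote; case: ifP => // _; case: ifP. Qed.

Lemma sum_neq_const (X : finType) (x0 : X) (k : int) :
  \sum_(x | x != x0) k = k * (#|X|%:Z - 1).
Proof.
have gt0 : (0 < #|X|)%N by apply/card_gt0P; exists x0.
rewrite sumr_const -[k in LHS]mulr1 -mulrnAr natz; congr (_ * _).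
by rewrite cardC1; lia.
Qed.

(** If some [x0] improves, it contributes 1 and every other element at least -1. If none improves,
    then [r (f x) <= r (g x)] for all [x]; since [f] and [g] are bijections, both sides have the
    same total, so equality holds termwise, [f] and [g] agree, and the sum is 0. *)
Lemma sum_rank_vote_perm (X Y : finType) (f g : X -> Y) (r : Y -> nat) :
  #|X| = #|Y| -> (1 < #|X|)%N -> injective f -> injective g -> injective r ->
  2 - #|X|%:Z <= \sum_x rank_vote (r (g x)) (r (f x)).
Proof.
move=> cXY gt1 f_inj g_inj r_inj.
case: (pickP (fun x => r (g x) < r (f x))%N) => [x0 lt0 | nlt].
  rewrite (bigD1 x0) //= {1}/rank_vote lt0.
  have add1 (i s : int) : - 1 * (i - 1) <= s -> 2 - i <= 1 + s by lia.
  apply: add1; rewrite -(sum_neq_const x0).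
  by apply: ler_sum => x _; apply: rank_vote_geN1.
suff eq_fg x : f x = g x.
  have le0 (k : nat) : (1 < k)%N -> 2 - k%:Z <= 0 by lia.
  rewrite big1 ?le0 // => x _.
  by rewrite /rank_vote eq_fg ltnn.
have sum_r (h : X -> Y) : injective h -> (\sum_x r (h x) = \sum_y r y)%N.
  move=> h_inj; have [k hK kK] : bijective h := inj_card_bij h_inj (eq_leq (esym cXY)).
  by rewrite [RHS](reindex h) //; exists k => ? _.
have le_fg (i : X) : true -> (r (f i) <= r (g i) ?= iff (r (f i) == r (g i)))%N.
  by move=> _; apply: leqif_eq; rewrite leqNgt nlt.
have [_] := leqif_sum le_fg; rewrite !sum_r // eqxx => /esym/forallP/(_ x).
by move/eqP/r_inj.
Qed.

Lemma index_prev (Y : eqType) (m : seq Y) (y0 y : Y) : uniq m -> y \in m ->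
  y != head y0 m -> (index (prev m y) m < index y m)%N.
Proof.
move=> m_uniq ym; rewrite prev_nth ym.
case: m m_uniq ym => [//|z m] zm_uniq ym /= yz.
rewrite [z == y]eq_sym (negPf yz) ltnS.
have y_in_m : y \in m by move: ym; rewrite inE (negPf yz).
have lt_m : (index y m < size m)%N by rewrite index_mem.
by rewrite [X in (X <= _)%N](index_uniq _ _ zm_uniq) //= ltnS ltnW.
Qed.

Lemma sum_rank_vote_prev (X Y : finType) (f : X -> Y) (m : seq Y) :
  #|X| = #|Y| -> (0 < #|X|)%N -> injective f -> complete_list m ->
  #|X|%:Z - 2 <=
    \sum_x rank_vote (index (prev m (f x)) m) (index (f x) m).
Proof.
move=> cXY gt0 f_inj /andP[m_uniq /forallP m_all].
have /card_gt0P[x1 _] := gt0.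
have [k fK kK] : bijective f := inj_card_bij f_inj (eq_leq (esym cXY)).
(* [x0] holds the top of the list, so the cyclic shift sends it to the last entry; it is the only
   element that may lose. The value [f x1] is just a default for [head]. *)
pose x0 := k (head (f x1) m).
rewrite (bigD1 x0) //=.
have -> : \sum_(x | x != x0)
    rank_vote (index (prev m (f x)) m) (index (f x) m) = #|X|%:Z - 1.
  rewrite (eq_bigr (fun=> 1)) => [|x x_x0]; last first.
    rewrite /rank_vote (@index_prev _ _ (f x1)) //.
    by apply: contraNneq x_x0 => /(congr1 k); rewrite fK => ->.
  by rewrite sum_neq_const mul1r.
have add1 (i s : int) : -1 <= s -> i - 2 <= s + (i - 1) by lia.
exact/add1/rank_vote_geN1.
Qed.

Lemma prev_inj (Y : eqType) (m : seq Y) : uniq m -> injective (prev m).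
Proof. by move=> m_uniq; apply: can_inj (next_prev m_uniq). Qed.

(** Two complete lists have the same length, and a subsequence of full length is the whole list. *)
Lemma derived_eq (X Y : finType) (l : X -> seq Y) :
  (forall x, complete_list (l x)) -> master_list_derived l ->
  exists2 m, complete_list m & forall x, l x = m.
Proof.
move=> l_comp [m m_comp l_m]; exists m => // x.
have /andP[l_uniq /forallP l_all] := l_comp x.
have /andP[m_uniq /forallP m_all] := m_comp.
apply/eqP; rewrite -(size_subseq_leqif (l_m x)); apply/eqP/perm_size.
by apply: uniq_perm => // y; rewrite l_all m_all.
Qed.

End Ranks.

(** * Partners, unmatched agents and the size of popular matchings *)

Section Matching.

Variables A B C : finType.
Implicit Types (I : instance A B C) (M : {set A * B * C}) (t : A * B * C).

Lemma matchingP M :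
  matching M <-> forall x t u, t \in M -> u \in M ->
                   occurs x t -> occurs x u -> t = u.
Proof.
split=> [M_match x t u tM uM xt xu | M_inj x].
  by apply/esym; apply: (card_le1_eqP (M_match x)); rewrite inE ?tM ?uM.
apply/card_le1_eqP=> t u; rewrite !inE => /andP[tM xt] /andP[uM xu].
exact/esym/(M_inj x).
Qed.

Lemma partnerE M x t :
  matching M -> t \in M -> occurs x t -> partner M x = successor x t.
Proof.
move=> /matchingP M_inj tM xt; rewrite /partner.
case: pickP => [u /andP[uM xu] | /(_ t)]; last by rewrite /= tM xt.
by rewrite (M_inj x t u).
Qed.

Lemma partner_unmatched M x :
  (forall t, t \in M -> ~~ occurs x t) -> partner M x = x.
Proof.
move=> x_free; rewrite /partner; case: pickP => // t /andP[tM].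
by rewrite (negPf (x_free t tM)).
Qed.

Lemma vote_id I x M M' : partner M' x = partner M x -> vote I x M' M = 0.
Proof. by move=> eqM; rewrite /vote /prefers eqM ltnn. Qed.

(** The list of [x] contains all agents of the next class, and [x] itself comes only after them. *)
Lemma vote_matched I x M M' t :
  partner M x = x -> partner M' x = successor x t -> vote I x M' M = 1.
Proof.
move=> Mx M'x; rewrite /vote Mx M'x /prefers /pref_list.
set l := (X in rcons X x).
have [yl xl] : successor x t \in l /\ x \notin l.
  rewrite /l; case: x {Mx M'x l} => [[a|b]|c] /=; split.
  - apply: map_f; have /andP[_ /forallP] := listA_complete I a; exact.
  - by apply/mapP=> -[].
  - apply: map_f; have /andP[_ /forallP] := listB_complete I b; exact.
  - by apply/mapP=> -[].
  - apply: map_f; have /andP[_ /forallP] := listC_complete I c; exact.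
  - by apply/mapP=> -[].
by rewrite -!cats1 !index_cat yl (negPf xl) /= eqxx addn0 index_mem yl.
Qed.

Lemma uncovered (T : finType) (p : A * B * C -> T) M :
  (#|M| < #|T|)%N -> exists x, forall t, t \in M -> p t != x.
Proof.
move=> ltMT; case: (pickP [predC p @: M]) => [x /= xM | all_in].
  by exists x => t tM; apply: contraNneq xM => <-; apply: imset_f.
have : (#|T| <= #|p @: M|)%N.
  apply/subset_leq_card/subsetP => x _.
  by have /negbFE := all_in x.
by move/leq_trans/(_ (leq_imset_card p M)); rewrite leqNgt ltMT.
Qed.

Lemma covered (T : finType) (p : A * B * C -> T) M :
  {in M &, injective p} -> (#|T| <= #|M|)%N ->
  forall x, exists2 t, t \in M & p t = x.
Proof.
move=> p_inj leTM x; have : p @: M = [set: T].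
  by apply/eqP; rewrite eqEcard subsetT cardsT card_in_imset.
by move/setP/(_ x); rewrite inE => /imsetP[t tM ->]; exists t.
Qed.

Lemma popular_card I M n :
  #|A| = n -> #|B| = n -> #|C| = n -> popular I M -> (n <= #|M|)%N.
Proof.
move=> cA cB cC [M_match M_pop]; rewrite leqNgt; apply/negP => lt_n.
have [a a_free] := @uncovered A (fun t => t.1.1) M ltac:(by rewrite cA).
have [b b_free] := @uncovered B (fun t => t.1.2) M ltac:(by rewrite cB).
have [c c_free] := @uncovered C (fun t => t.2) M ltac:(by rewrite cC).
have free x t : occurs x (a, b, c) -> t \in M -> ~~ occurs x t.
  move=> + tM; case: x => [[a'|b']|c'] /= /eqP <-.
  - exact: a_free.
  - exact: b_free.
  - exact: c_free.
have M'_match : matching ((a, b, c) |: M).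
  apply/matchingP => x t u /setU1P[-> | tM] /setU1P[-> | uM] // xt xu.
  - by rewrite (negPf (free x u xt uM)) in xu.
  - by rewrite (negPf (free x t xu tM)) in xt.
  - exact: (proj1 (matchingP M) M_match x).
apply: M_pop; exists ((a, b, c) |: M) => //.
have vote1 x : occurs x (a, b, c) -> vote I x ((a, b, c) |: M) M = 1.
  move=> xt; apply: (@vote_matched _ _ _ _ (a, b, c)).
    by apply: partner_unmatched => t; apply: free.
  by apply: partnerE; rewrite ?setU11.
have vote0 x : ~~ occurs x (a, b, c) -> vote I x ((a, b, c) |: M) M = 0.
  move=> xt; apply: vote_id.
  case: (pickP [pred t in M | occurs x t]) => [t /andP[tM xt'] | none].
    by rewrite !(@partnerE _ x t) // setU1r.
  have noM t : t \in M -> ~~ occurs x t.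
    by move=> tM; have /= := none t; rewrite tM /= => ->.
  by rewrite !partner_unmatched // => t /setU1P[-> | /noM].
(* The gain of [a] alone suffices, since every other agent votes 0 or 1. *)
rewrite /more_popular (bigD1 (agentA B C a)) //= vote1 /= ?eqxx //.
rewrite lerDl; apply: sumr_ge0 => x _.
by case: (boolP (occurs x (a, b, c))) => [/vote1 -> | /vote0 ->].
Qed.

(** * Perfect matchings described by their three partner maps *)

Definition partner_maps M (f : A -> B) (g : B -> C) (h : C -> A) : Prop :=
  [/\ forall a, partner M (agentA B C a) = agentB A C (f a),
      forall b, partner M (agentB A C b) = agentC A B (g b)
    & forall c, partner M (agentC A B c) = agentA B C (h c)].

(** Each projection is injective on [M], hence onto its class by counting, so every agent lies in a
    triple. The maps are injective because a triple is determined by any one of its coordinates. *)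
Lemma perfect_partner_maps M n :
  #|A| = n -> #|B| = n -> #|C| = n -> matching M -> (n <= #|M|)%N ->
  exists f g h, [/\ injective f, injective g, injective h & partner_maps M f g h].
Proof.
move=> cA cB cC M_match le_n.
have M_inj := proj1 (matchingP M) M_match.
have injA : {in M &, injective (fun t => t.1.1)}.
  by move=> t u tM uM eq_tu; apply: (M_inj (agentA B C u.1.1)); rewrite //= eq_tu.
have injB : {in M &, injective (fun t => t.1.2)}.
  by move=> t u tM uM eq_tu; apply: (M_inj (agentB A C u.1.2)); rewrite //= eq_tu.
have injC : {in M &, injective (fun t => t.2)}.
  by move=> t u tM uM eq_tu; apply: (M_inj (agentC A B u.2)); rewrite //= eq_tu.
have exA a : exists t, t \in M /\ t.1.1 = a.
  by have [|t] := covered injA _ a; [rewrite cA | exists t].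
have exB b : exists t, t \in M /\ t.1.2 = b.
  by have [|t] := covered injB _ b; [rewrite cB | exists t].
have exC c : exists t, t \in M /\ t.2 = c.
  by have [|t] := covered injC _ c; [rewrite cC | exists t].
have [tA tAP] := fin_all_exists exA.
have [tB tBP] := fin_all_exists exB.
have [tC tCP] := fin_all_exists exC.
exists (fun a => (tA a).1.2), (fun b => (tB b).2), (fun c => (tC c).1.1).
split=> [a a' | b b' | c c' |].
- have [tM ta] := tAP a; have [uM ua] := tAP a'.
  by move=> /injB eq_tu; rewrite -ta -ua eq_tu.
- have [tM tb] := tBP b; have [uM ub] := tBP b'.
  by move=> /injC eq_tu; rewrite -tb -ub eq_tu.
- have [tM tc] := tCP c; have [uM uc] := tCP c'.
  by move=> /injA eq_tu; rewrite -tc -uc eq_tu.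
split=> [a | b | c].
- by have [tM ta] := tAP a; rewrite (partnerE M_match tM) //= ta.
- by have [tM tb] := tBP b; rewrite (partnerE M_match tM) //= tb.
- by have [tM tc] := tCP c; rewrite (partnerE M_match tM) //= tc.
Qed.

(** The triples [(a, f a, g (f a))] form a perfect matching: two of the partner maps can be
    prescribed freely, and they force the third. *)
Lemma exists_matching (f : A -> B) (g : B -> C) n :
  #|A| = n -> #|B| = n -> #|C| = n -> injective f -> injective g ->
  exists2 M, matching M & exists2 h, injective h & partner_maps M f g h.
Proof.
move=> cA cB cC f_inj g_inj.
pose t a := (a, f a, g (f a)); pose M := [set t a | a : A].
have M_match : matching M.
  apply/matchingP => x _ _ /imsetP[a _ ->] /imsetP[a' _ ->].
  case: x => [[a1|b1]|c1] /= /eqP <- /eqP => [-> // | /f_inj -> // |].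
  by move=> /g_inj/f_inj ->.
have leM : (n <= #|M|)%N by rewrite card_imset ?cA // => a a' [].
have [f' [g' [h [_ _ h_inj [f'E g'E hE]]]]] :=
  perfect_partner_maps cA cB cC M_match leM.
exists M => //; exists h => //; split=> // [a | b].
  by rewrite (@partnerE _ _ (t a)) ?imset_f //= eqxx.
(* The triple through [b] is the one starting at its preimage [k b]. *)
have [k fK kK] : bijective f := inj_card_bij f_inj (eq_leq (etrans cB (esym cA))).
by rewrite (@partnerE _ _ (t (k b))) ?imset_f //= ?kK.
Qed.

(** Nobody is unmatched in either matching, so the agent appended to its own list never enters a
    comparison. *)
Lemma sum_votes I M M' f g h f' g' h' :
  partner_maps M f g h -> partner_maps M' f' g' h' ->
  \sum_x vote I x M' M =
    \sum_a rank_vote (index (f' a) (listA I a)) (index (f a) (listA I a))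
  + \sum_b rank_vote (index (g' b) (listB I b)) (index (g b) (listB I b))
  + \sum_c rank_vote (index (h' c) (listC I c)) (index (h c) (listC I c)).
Proof.
have idx (X Y : eqType) (i : X -> Y) (s : seq X) (x : X) y :
    injective i -> x \in s -> index (i x) (rcons (map i s) y) = index x s.
  by move=> i_inj xs; rewrite -cats1 index_cat mem_map // xs index_map.
have inA a b : b \in listA I a.
  by have /andP[_ /forallP] := listA_complete I a; apply.
have inB b c : c \in listB I b.
  by have /andP[_ /forallP] := listB_complete I b; apply.
have inC c a : a \in listC I c.
  by have /andP[_ /forallP] := listC_complete I c; apply.
move=> [fE gE hE] [f'E g'E h'E].
rewrite !big_sumType /=; congr (_ + _ + _); apply: eq_bigr => x _.
- have i_inj : injective (@agentB A B C) by move=> ? ? [].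
  by rewrite /vote fE f'E /prefers /= !idx.
- have i_inj : injective (@agentC A B C) by move=> ? ? [].
  by rewrite /vote gE g'E /prefers /= !idx.
- have i_inj : injective (@agentA A B C) by move=> ? ? [].
  by rewrite /vote hE h'E /prefers /= !idx.
Qed.

End Matching.

Local Close Scope ring_scope.

Theorem theorem7 (n : nat) (A B C : finType)
    (cardA : #|A| = n) (cardB : #|B| = n) (cardC : #|C| = n)
    (I : instance A B C) :
  k_master_list_derived 3 I -> 3 <= n -> ~ exists M : {set A * B * C}, popular I M.
Proof.
move=> [dA [dB [dC [sum_d derA derB derC]]]] n_ge3 [M M_pop].
have [dA1 dB1 dC1] : [/\ dA, dB & dC].
  by case: dA dB dC sum_d {derA derB derC} => [] [] [].
have [mA mA_comp mAE] := derived_eq (listA_complete I) (derA dA1).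
have [mB mB_comp mBE] := derived_eq (listB_complete I) (derB dB1).
have [mC mC_comp mCE] := derived_eq (listC_complete I) (derC dC1).
have /andP[mA_uniq _] := mA_comp; have /andP[mB_uniq _] := mB_comp.
have /andP[mC_uniq /forallP mC_all] := mC_comp.
have le_n := popular_card cardA cardB cardC M_pop.
have [M_match M_best] := M_pop.
have [f [g [h [f_inj g_inj h_inj M_maps]]]] :=
  perfect_partner_maps cardA cardB cardC M_match le_n.
(* The rival moves every partner map of [A] and [B] one place up the master list, cyclically; about
   the resulting [h'] only injectivity is needed. *)
have [M' M'_match [h' h'_inj M'_maps]] :=
  exists_matching cardA cardB cardC (inj_comp (prev_inj mA_uniq) f_inj)
    (inj_comp (prev_inj mB_uniq) g_inj).
apply: M_best; exists M' => //.
rewrite /more_popular (sum_votes I M_maps M'_maps).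
under eq_bigr do rewrite mAE; under [X in (_ + X + _)%R]eq_bigr do rewrite mBE.
under [X in (_ + X)%R]eq_bigr do rewrite mCE.
have [A_gt0 B_gt0 C_gt1] : [/\ 0 < #|A|, 0 < #|B| & 1 < #|C|].
  by rewrite cardA cardB cardC; split; lia.
have rank_inj : injective (fun a => index a mC).
  by move=> a a'; apply: index_inj; rewrite ?mC_all.
have sumA := sum_rank_vote_prev (etrans cardA (esym cardB)) A_gt0 f_inj mA_comp.
have sumB := sum_rank_vote_prev (etrans cardB (esym cardC)) B_gt0 g_inj mB_comp.
have sumC := sum_rank_vote_perm (etrans cardC (esym cardA)) C_gt1
  h_inj h'_inj rank_inj.
rewrite cardA in sumA; rewrite cardB in sumB; rewrite cardC in sumC.
(* The three bounds add up to [n - 2], which is at least 1 because [n >= 3]. *)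
have add3 (i j k : int) : (n%:Z - 2 <= i -> n%:Z - 2 <= j -> 2 - n%:Z <= k ->
    1 <= i + j + k)%R by lia.
exact: add3 sumA sumB sumC.
Qed.
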